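(* Let $n,m\ge 1$ be integers and let $D$ be a set with $|D|=n$. Let $g_1,\ldots,g_{n!}$ be the elements of $Sym(D)$, and for each $1\le r\le n!$ let $k_{r1},\ldots,k_{r\ell_r}$ be the cycle type of $g_r$. Then the number of $m$-endomorphisms on $D^+$, up to combinatorial equivalence (i.e. the number of combinatorial equivalence classes of $m$-endomorphisms on $D^+$), is $$\frac{1}{n!}\sum_{r=1}^{n!}\Bigg(\prod_{i=1}^{\ell_r}\bigg(\sum_{k=1}^m\Big(\sum_{j\mid k_{ri}}j\,c(g_r,j)\Big)^k\bigg)\Bigg),$$ where the innermost sum is over the positive divisors $j$ of $k_{ri}$.
   Context: $D^+$ is the free semigroup on $D$: the set of all finite strings $d_1\ldots d_k$ ($k\ge 1$, $d_i\in D$) under concatenation; $|W|$ denotes the length of a string $W$. An endomorphism on $D^+$ is a map $\phi:D^+\to D^+$ with $\phi(W_1W_2)=\phi(W_1)\phi(W_2)$ for all $W_1,W_2\in D^+$. Any map $f:D\to D^+$ extends uniquely to an endomorphism $\phi_f$, given by $\phi_f(d_1\ldots d_k)=f(d_1)\ldots f(d_k)$. An $m$-endomorphism on $D^+$ is an endomorphism $\phi$ with $|\phi(d)|\le m$ for all $d\in D$. Two $m$-endomorphisms $\phi,\psi$ on $D^+$ are combinatorially equivalent if there is a bijection $g:D\to D$ such that $\psi\circ\phi_g=\phi_g\circ\phi$ (this is an equivalence relation). $Sym(D)$ is the group of all bijections $D\to D$. If $g\in Sym(D)$ is the product of disjoint cycles of lengths $k_1\le k_2\le\cdots\le k_\ell$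 (fixed points counted as cycles of length 1), then the sequence $k_1,\ldots,k_\ell$ is the cycle type of $g$. For a positive integer $j$, $c(g,j)$ is the number of cycles of length $j$ in the cycle decomposition of $g$. *)

(* Defs.v *)
From HB Require Import structures.
From mathcomp Require Import all_boot all_order all_algebra all_fingroup.
From mathcomp Require Import boolp classical_sets functions cardinality.

Set Implicit Arguments.
Unset Strict Implicit.
Unset Printing Implicit Defensive.

(** * The free semigroup D^+ *)

Definition word (D : Type) : Type := {s : seq D | (0 < size s)%N}.

Definition wlen (D : Type) (W : word D) : nat := size (sval W).

Definition letter (D : Type) (d : D) : word D :=
  exist (fun s : seq D => (0 < size s)%N) [:: d] isT.

Lemma wcat_subproof (D : Type) (V W : word D) : (0 < size (sval V ++ sval W))%N.
Proof. by rewrite size_cat addn_gt0 (svalP V). Qed.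

Definition wcat (D : Type) (V W : word D) : word D :=
  exist (fun s : seq D => (0 < size s)%N) _ (wcat_subproof V W).

(** * Endomorphisms of D^+ *)

Definition is_endo (D : Type) (phi : word D -> word D) : Prop :=
  forall V W : word D, phi (wcat V W) = wcat (phi V) (phi W).

Definition is_mendo (D : Type) (m : nat) (phi : word D -> word D) : Prop :=
  is_endo phi /\ forall d : D, (wlen (phi (letter d)) <= m)%N.

Lemma extend_subproof (D : Type) (f : D -> word D) (W : word D) :
  (0 < size (flatten [seq sval (f d) | d <- sval W]))%N.
Proof.
by case: W => -[|d s] //= _; rewrite size_cat addn_gt0 (svalP (f d)).
Qed.

(* [extend f] is the endomorphism d_1 ... d_k |-> f(d_1) ... f(d_k). *)
Definition extend (D : Type) (f : D -> word D) (W : word D) : word D :=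
  exist (fun s : seq D => (0 < size s)%N) _ (extend_subproof f W).

Definition comb_equiv (D : Type) (phi psi : word D -> word D) : Prop :=
  exists g : D -> D, bijective g /\
    psi \o extend (@letter D \o g) = extend (@letter D \o g) \o phi.

(* The quotient, realized as a set of sets of endomorphisms: its elements are
   the equivalence classes themselves. *)
Definition mendo_classes (D : Type) (m : nat) :
    set (set (word D -> word D)) :=
  [set [set psi | is_mendo m psi /\ comb_equiv phi psi]
     | phi in [set phi | is_mendo m phi]]%classic.
Arguments mendo_classes D m : clear implicits.

(** * Cycle structure of permutations *)

(* [porbits g] is the set of supports of the cycles of [g]; it contains a
   singleton for each fixed point. *)
Definition cycle_type (D : finType) (g : {perm D}) : seq nat :=
  sort leq [seq #|C| | C : {set D} <- enum (porbits g)].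

Definition ncycles (D : finType) (g : {perm D}) (j : nat) : nat :=
  #|[set C in porbits g | #|C| == j]|.

(* Main.v *)
(* Equivalence classes of m-endomorphisms are the orbits of Sym(D) acting by
   conjugation on the maps from D to words of length at most m, so they are counted
   by the Cauchy-Frobenius lemma.  A map f is fixed by g iff f (g d) = g (f d) for
   all d; it is then freely determined by one word per cycle C of g, fixed letterwise
   by g^#|C|, and the letters fixed by g^k are those lying in the cycles of length
   dividing k. *)
Require Import Defs.
From mathcomp Require Import all_boot all_order all_algebra all_fingroup.
From mathcomp Require Import boolp classical_sets functions cardinality.

Set Implicit Arguments.
Unset Strict Implicit.
Unset Printing Implicit Defensive.

(** * Permutation cycles and equivariant maps *)

Section Equivariant.
Variables (X Y : finType) (g : {perm X}) (h : Y -> Y).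

(** One turn around the cycle returns to [x], so only [k] modulo the cycle length matters, and the
    points within one turn are distinct. *)
Lemma iter_perm_fix (x : X) (k : nat) :
  (iter k g x == x) = (#|porbit g x| %| k).
Proof.
have p0 : 0 < #|porbit g x| by rewrite lt0n card_porbit_neq0.
have iterM q : iter (q * #|porbit g x|) g x = x.
  by elim: q => [|q IH] //; rewrite mulSn iterD IH iter_porbit.
rewrite {1}(divn_eq k #|porbit g x|) addnC iterD iterM /dvdn.
have lt := ltn_pmod k p0; set r := k %% _ in lt *.
rewrite -[X in _ == X]/(iter 0 g x) -(nth_traject g lt) -(nth_traject g p0).
by rewrite nth_uniq ?size_traject ?uniq_traject_porbit.
Qed.

(** The fixed points of the [k]-th iterate fill exactly the cycles whose length divides [k]; these
    are then grouped by length. *)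
Lemma card_fix_iter_perm (k : nat) : 0 < k ->
  #|[set x | iter k g x == x]| = \sum_(j <- divisors k) j * ncycles g j.
Proof.
move=> k0; transitivity (\sum_(C in porbits g | #|C| %| k) #|C|).
  rewrite -sum1_card (eq_bigl (fun x => #|porbit g x| %| k)); last first.
    by move=> x; rewrite inE iter_perm_fix.
  rewrite big_mkcond (partition_big_imset (porbit g)) [RHS]big_mkcondr /=.
  apply: eq_bigr => _ /imsetP[x _ ->].
  rewrite (eq_bigr (fun=> if #|porbit g x| %| k then 1 else 0)) => [|y /eqP-> //].
  rewrite (eq_bigl (fun y => y \in porbit g x)) => [|y]; last exact: eq_porbit_mem.
  by case: ifP => _; rewrite ?sum1_card // big1.
transitivity (\sum_(j <- divisors k) \sum_(C in porbits g | #|C| == j) #|C|).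
  rewrite [LHS]big_mkcondr /= (eq_bigr _ (fun j _ => big_mkcondr _ _ _ _ _)) /=.
  rewrite exchange_big /=; apply: eq_bigr => C _.
  rewrite dvdn_divisors //; case: ifP => kC.
    rewrite (bigD1_seq #|C|) ?divisors_uniq //= eqxx big1 ?addn0 // => j.
    by rewrite eq_sym => /negPf->.
  rewrite big1_seq // => j /andP[_ jk].
  by case: eqP jk kC => // <- ->.
apply: eq_bigr => j _; rewrite mulnC /ncycles -sum1_card big_distrl /=.
rewrite [RHS](eq_bigl (fun C : {set X} => (C \in porbits g) && (#|C| == j))).
  by apply: eq_bigr => C /andP[_ /eqP->]; rewrite mul1n.
by move=> C; rewrite inE.
Qed.

(* An equivariant map is determined by its values at one base point per cycle of [g],
   and such a value is constrained only by the return to the base point. *)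
Lemma card_equivariant (y0 : Y) :
  #|[set f : {ffun X -> Y} | [forall x, f (g x) == h (f x)]]| =
  \prod_(C in porbits g) #|[set y | iter #|C| h y == y]|.
Proof.
pose base (C : {set X}) : option X := [pick x in C].
have baseP x : {b | base (porbit g x) = Some b & porbit g b = porbit g x}.
  rewrite /base; case: pickP => [b bx|/(_ x)]; last by rewrite porbit_id.
  by exists b => //; apply/eqP; rewrite eq_porbit_mem.
(* Restriction to base points; the value [y0] away from the cycles makes [R f] a member of a
   [pfamily], whose cardinality is a product. *)
pose R (f : {ffun X -> Y}) : {ffun {set X} -> Y} :=
  [ffun C => if base C is Some b then if C \in porbits g then f b else y0 else y0].
pose F (C : {set X}) := [pred y | iter #|C| h y == y].
have equivI (f : {ffun X -> Y}) : (forall x, f (g x) = h (f x)) ->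
    forall i x, f (iter i g x) = iter i h (f x).
  by move=> fg; elim=> [|i IH] x //=; rewrite fg IH.
transitivity #|pfamily y0 (porbits g) F|; last first.
  rewrite card_pfamily foldrE big_map big_enum /=.
  by apply: eq_bigr => C _; apply: eq_card => y; rewrite inE.
rewrite -(card_in_imset (f := R)).
  apply: eq_card => G; apply/imsetP/pfamilyP => [[f]|[Gsupp Gfix]].
    rewrite inE => /forallP/(_ _)/eqP fg ->; split.
      apply/fintype.subsetP => C; rewrite inE /= ffunE;
        case: (base C) => [b|]; last by rewrite eqxx.
      by case: ifP => // _; rewrite eqxx.
    move=> _ /imsetP[x _ ->]; have [b bE bx] := baseP x.
    by rewrite ffunE bE imset_f //= inE -equivI // -bx iter_porbit.
  (* Conversely, a choice [G] of one value per cycle extends to [f]: [x] lies [depth x] steps after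
     its base point, so [h] is applied that many times. *)
  pose point x := odflt x (base (porbit g x)).
  pose depth x := index x (traject g (point x) #|porbit g x|).
  have point_orbit x : porbit g (point x) = porbit g x.
    by rewrite /point; have [b -> bx] := baseP x.
  have pointE x y : porbit g x = porbit g y -> point x = point y.
    by rewrite /point => ->; have [b ->] := baseP y.
  have depth_lt x : depth x < #|porbit g x|.
    by rewrite -[X in _ < X](size_traject g (point x)) index_mem -point_orbit
               -porbit_traject point_orbit porbit_id.
  have iter_depth x : iter (depth x) g (point x) = x.
    rewrite -(nth_traject g (depth_lt x)) nth_index //.
    by rewrite -index_mem size_traject depth_lt.
  have depth_iter x i : i < #|porbit g x| -> x = iter i g (point x) -> depth x = i.
    move=> lti xE; rewrite /depth {1}xE -(nth_traject g lti).
    by rewrite index_uniq ?size_traject // -point_orbit uniq_traject_porbit.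
  have orbit_g x : porbit g (g x) = porbit g x.
    by have := porbit_perm g 1 x; rewrite expg1.
  pose f := [ffun x => iter (depth x) h (G (porbit g x))].
  exists f.
    rewrite inE; apply/forallP => x; rewrite !ffunE orbit_g -iterS.
    have gxE : g x = iter (depth x).+1 g (point (g x)).
      by rewrite (pointE _ _ (orbit_g x)) iterS iter_depth.
    (* Either the depth grows by one, or [g x] is the base point again: the depth drops to 0 and
       [Gfix] closes the cycle. *)
    have [lt|ge] := ltnP (depth x).+1 #|porbit g x|.
      by rewrite (depth_iter (g x) _ _ gxE) ?orbit_g.
    have dE : (depth x).+1 = #|porbit g x| by apply/eqP; rewrite eqn_leq ge depth_lt.
    rewrite (depth_iter (g x) 0) ?orbit_g ?(leq_trans _ (depth_lt x)) //=.
      by rewrite eq_sym -iterS dE (eqP (Gfix _ _)) ?imset_f.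
    by rewrite {1}gxE dE -(orbit_g x) -point_orbit iter_porbit.
  apply/ffunP => C; rewrite ffunE.
  have [/imsetP[x _ ->]|CN] := boolP (C \in porbits g); last first.
    rewrite (_ : G C = y0); first by case: (base C).
    by apply/eqP/negPn/negP => /(fintype.subsetP Gsupp); rewrite (negPf CN).
  have [b bE bx] := baseP x; rewrite bE ffunE (depth_iter b 0) ?bx //=.
    by rewrite -bx lt0n card_porbit_neq0.
  by rewrite /point bx bE.
(* Injectivity of [R]: each [x] is an iterate of its base point, where [f1] and [f2] agree. *)
move=> f1 f2; rewrite !inE => /forallP/(_ _)/eqP f1g /forallP/(_ _)/eqP f2g eqR.
apply/ffunP => x; have [b bE bx] := baseP x.
have /trajectP[i _ ->] : x \in traject g b #|porbit g b|.
  by rewrite -porbit_traject bx porbit_id.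
rewrite !equivI //; congr iter.
by have := congr1 (fun R : {ffun _} => R (porbit g x)) eqR; rewrite !ffunE bE imset_f.
Qed.

End Equivariant.

(** * A finite model of the words of length at most m *)

Section ShortWords.
Variables (D : finType) (m : nat).

(* The nonempty words of length at most [m]; the tag [k] stands for length [k.+1]. *)
Definition short_word := {k : 'I_m & {ffun 'I_k.+1 -> D}}.

Definition map_short (g : D -> D) (w : short_word) : short_word :=
  Tagged (fun k : 'I_m => {ffun 'I_k.+1 -> D}) [ffun i => g (tagged w i)].

Lemma word_inj (V W : word D) : sval V = sval W -> V = W.
Proof. by case: V W => [s s0] [t t0] /= st; apply: eq_exist. Qed.

Lemma short_subproof (w : short_word) : 0 < size (codom (tagged w)).
Proof. by rewrite size_codom card_ord. Qed.

Definition word_of_short (w : short_word) : word D :=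
  exist (fun s : seq D => 0 < size s) _ (short_subproof w).

Lemma word_of_short_inj : injective word_of_short.
Proof.
move=> [k f] [l f'] /(congr1 sval)/= eqw.
have kl : k = l.
  by apply/val_inj; have := congr1 size eqw; rewrite !size_codom !card_ord => -[].
subst l; congr existT; apply/ffunP => i.
by move/eq_in_map: eqw => ->; rewrite ?mem_enum.
Qed.

Lemma wlen_word_of_short w : wlen (word_of_short w) <= m.
Proof. by rewrite /wlen size_codom card_ord. Qed.

Lemma short_of_word (W : word D) :
  wlen W <= m -> exists w, word_of_short w = W.
Proof.
case: W => [[|d s] s0] //; rewrite /wlen /= => ltm.
(* The tag is [size s], one less than the length, so [ltm] is its bound by conversion; [d] is only a
   default for [nth]. *)
exists (Tagged (fun k : 'I_m => {ffun 'I_k.+1 -> D})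
               [ffun i : 'I_(Ordinal ltm).+1 => nth d (d :: s) i]).
apply: word_inj; rewrite /= -[RHS](mkseq_nth d) /mkseq -val_enum_ord -map_comp.
by apply: eq_map => i; rewrite ffunE.
Qed.

Lemma sval_extend_renaming (g : D -> D) W :
  sval (extend (@letter D \o g) W) = map g (sval W).
Proof. by rewrite /= -[RHS]flatten_seq1 -map_comp. Qed.

Lemma word_of_map_short g w :
  word_of_short (map_short g w) = extend (@letter D \o g) (word_of_short w).
Proof.
apply: word_inj; rewrite sval_extend_renaming /= -map_comp.
by apply: eq_map => i /=; rewrite ffunE.
Qed.

Lemma map_short_id w : map_short id w = w.
Proof. by case: w => k f; congr existT; apply/ffunP => i; rewrite ffunE. Qed.

Lemma map_short_comp g h w : map_short (g \o h) w = map_short g (map_short h w).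
Proof. by congr existT; apply/ffunP => i; rewrite !ffunE. Qed.

Lemma iter_map_short k g w : iter k (map_short g) w = map_short (iter k g) w.
Proof. by elim: k => [|k IH] /=; rewrite ?map_short_id // IH -map_short_comp. Qed.

(** A word is fixed letterwise exactly when all its letters are fixed; the words are counted length
    by length. *)
Lemma card_fix_map_short (g : D -> D) :
  #|[set w | map_short g w == w]| =
  \sum_(1 <= e < m.+1) #|[set x | g x == x]| ^ e.
Proof.
rewrite big_add1 /= big_mkord.
transitivity (\sum_(k < m) \sum_(f : {ffun 'I_k.+1 -> D} |
                f \in ffun_on (mem [set x | g x == x])) 1); last first.
  by apply: eq_bigr => k _; rewrite sum1_card card_ffun_on card_ord.
rewrite sig_big_dep sum1_card; apply: eq_card.
move=> [k f]; rewrite !inE eq_sym eq_Tagged /=; apply/eqP/ffun_onP => [fE i|fE].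
  by have /ffunP/(_ i) := fE; rewrite inE ffunE => <-.
by apply/ffunP => i; rewrite ffunE; have := fE i; rewrite inE => /eqP.
Qed.

(** * The conjugation action of Sym(D) and its fixed points *)

Definition relabel (f : {ffun D -> short_word}) (g : {perm D}) :=
  [ffun d => map_short g (f (g^-1%g d))].

Lemma relabel1 f : relabel f 1 = f.
Proof.
apply/ffunP => d; rewrite ffunE invg1 perm1 (_ : map_short _ _ = map_short id (f d)).
  exact: map_short_id.
by congr map_short; apply/funext => x; rewrite perm1.
Qed.

Lemma relabelM f g h : relabel f (g * h)%g = relabel (relabel f g) h.
Proof.
apply/ffunP => d; rewrite !ffunE invMg permM -map_short_comp.
by congr map_short; apply/funext => x; rewrite permM.
Qed.

Canonical relabel_action := TotalAction relabel1 relabelM.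

Lemma relabel_eqP f g f' :
  relabel f g = f' <-> forall d, f' (g d) = map_short g (f d).
Proof.
split=> [<- d|f'g]; first by rewrite ffunE permK.
by apply/ffunP => d; rewrite ffunE -f'g permKV.
Qed.

(** Being fixed by [g] means being equivariant from [g] to [map_short g], so each cycle [C]
    contributes the words fixed by the [#|C|]-th iterate of [g]. *)
Lemma card_fix_relabel (d0 : D) (g : {perm D}) : 0 < m ->
  #|'Fix_relabel_action[g]%g| =
  \prod_(k <- cycle_type g) \sum_(1 <= e < m.+1)
     (\sum_(j <- divisors k) j * ncycles g j) ^ e.
Proof.
(* A one-letter word, serving as the default [y0] of [card_equivariant]. *)
move=> m0; have w0 : short_word by exists (Ordinal m0); exact: [ffun=> d0].
transitivity #|[set f : {ffun D -> short_word} |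
                [forall d, f (g d) == map_short g (f d)]]|.
  apply: eq_card => f; rewrite inE.
  by apply/afix1P/forallP => [/relabel_eqP fg d|fg];
    [rewrite fg | apply/relabel_eqP => d; exact/eqP].
rewrite card_equivariant // (perm_big _ (permEl (perm_sort _ _))) big_map big_enum /=.
apply: eq_bigr => _ /imsetP[x _ ->].
rewrite (eq_card (B := [set w | map_short (iter #|porbit g x| g) w == w])).
  rewrite card_fix_map_short card_fix_iter_perm // lt0n.
  exact: card_porbit_neq0.
by move=> w; rewrite !inE iter_map_short.
Qed.

(** * Equivalence classes of m-endomorphisms as orbits *)

Definition endo_of (f : {ffun D -> short_word}) : word D -> word D :=
  extend (fun d => word_of_short (f d)).

Lemma extend_endo (f : D -> word D) : is_endo (extend f).
Proof. by move=> V W; apply: word_inj; rewrite /= map_cat flatten_cat. Qed.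

Lemma extend_letter (f : D -> word D) d : extend f (letter d) = f d.
Proof. by apply: word_inj; rewrite /= cats0. Qed.

(** Induction on the length, starting from single letters since words are nonempty. *)
Lemma endo_ext (phi psi : word D -> word D) : is_endo phi -> is_endo psi ->
  (forall d, phi (letter d) = psi (letter d)) -> phi = psi.
Proof.
move=> phiM psiM eqL; apply/funext => -[s s0].
elim: s s0 => [//|d [|d' s] IH] s0.
  by rewrite (_ : exist _ _ _ = letter d) ?eqL //; apply: word_inj.
rewrite (_ : exist _ _ _ = wcat (letter d) (exist _ (d' :: s) isT)); last exact: word_inj.
by rewrite phiM psiM eqL IH.
Qed.

Lemma endo_of_inj : injective endo_of.
Proof.
move=> f f' ff'; apply/ffunP => d; apply: word_of_short_inj.
by rewrite -(extend_letter (fun d => word_of_short (f d))) -/(endo_of f) ff'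
           /endo_of extend_letter.
Qed.

Lemma mendoP (phi : word D -> word D) :
  is_mendo m phi <-> exists f, endo_of f = phi.
Proof.
split=> [[phiM phim]|[f <-]]; last first.
  by split=> [|d]; [exact: extend_endo|rewrite /endo_of extend_letter wlen_word_of_short].
have [f fE] := choice (fun d => short_of_word (phim d)).
exists (finfun f); apply: endo_ext => // [|d]; first exact: extend_endo.
by rewrite /endo_of extend_letter ffunE.
Qed.

(** Both sides of the intertwining relation are endomorphisms, so it can be tested on letters, where
    it becomes [relabel_eqP]. *)
Lemma comb_equiv_endo_of f f' :
  comb_equiv (endo_of f) (endo_of f') <-> f' \in orbit relabel_action [set: {perm D}] f.
Proof.
have equivE (g : {perm D}) : endo_of f' \o extend (@letter D \o g) =
    extend (@letter D \o g) \o endo_of f <-> relabel f g = f'.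
  rewrite relabel_eqP; split=> [eqg d|f'g].
    apply: word_of_short_inj; rewrite word_of_map_short.
    by have := congr1 (@^~ (letter d)) eqg; rewrite /endo_of /comp !extend_letter.
  apply: endo_ext => [V W|V W|d]; rewrite /endo_of /comp ?extend_endo //.
  by rewrite !extend_letter f'g word_of_map_short.
split=> [[g [gbij eqg]]|/imsetP[g _ f'E]].
  apply/imsetP; exists (perm (bij_inj gbij)) => //; apply/esym/equivE.
  have -> // : (perm (bij_inj gbij) : D -> D) = g by apply/funext => x; rewrite permE.
exists g; split; last exact/equivE/esym.
by exists (g^-1%g); [exact: permK | exact: permKV].
Qed.

Lemma card_mendo_classes :
  (mendo_classes D m #=
     `I_#|[set orbit relabel_action [set: {perm D}] f
             | f in [set: {ffun D -> short_word}]]|)%card.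
Proof.
set O := imset _ _.
pose cls (C : {set {ffun D -> short_word}}) : set (word D -> word D) :=
  [set endo_of f | f in [set` C]]%classic.
(* Numbering the orbits numbers the classes, each class being the image of an orbit under
   [endo_of]. *)
pose nthcls i := cls (nth finset.set0 (enum O) i).
have clsE f : [set psi | is_mendo m psi /\ comb_equiv (endo_of f) psi]%classic =
    cls (orbit relabel_action [set: {perm D}] f).
  apply/seteqP; split=> [psi [/mendoP[f' <-] /comb_equiv_endo_of ff']|_ [f' ff' <-]].
    by exists f'.
  by split; [apply/mendoP; exists f' | apply/comb_equiv_endo_of].
have -> : mendo_classes D m = (nthcls @` `I_#|O|)%classic.
  apply/seteqP; split=> [_ [_ /mendoP[f <-] <-]|_ [i iO <-]].
    have fO : orbit relabel_action [set: {perm D}] f \in O by exact: imset_f.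
    exists (index (orbit relabel_action [set: {perm D}] f) (enum O)).
      by rewrite /= cardE index_mem mem_enum.
    by rewrite /nthcls nth_index ?mem_enum // clsE.
  have : nth finset.set0 (enum O) i \in O by rewrite -mem_enum mem_nth // -cardE.
  rewrite /nthcls => /imsetP[f _ ->]; exists (endo_of f); last exact: clsE.
  by apply/mendoP; exists f.
(* If two orbits give the same class, then by injectivity of [endo_of] a representative of one lies
   in the other, so they coincide. *)
apply: inj_card_eq => i j /set_mem iO /set_mem jO eqij.
apply/eqP; rewrite -(nth_uniq finset.set0 _ _ (enum_uniq O)) -?cardE //; apply/eqP.
have mem_nthO k : k < #|O| -> nth finset.set0 (enum O) k \in O.
  by move=> kO; rewrite -mem_enum mem_nth // -cardE.
have [/imsetP[f _ fE] /imsetP[f' _ f'E]] := (mem_nthO i iO, mem_nthO j jO).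
rewrite /nthcls fE f'E in eqij *.
have [f1 f1f' /endo_of_inj ff1] :
    cls (orbit relabel_action [set: {perm D}] f') (endo_of f).
  by rewrite -eqij; exists f => //=; exact: orbit_refl.
by apply/orbit_eqP; rewrite -ff1.
Qed.
End ShortWords.

Theorem theorem1 (n m : nat) (D : finType)
  (hn : (1 <= n)%N) (hm : (1 <= m)%N) (hD : #|D| = n) :
  exists N : nat,
    (mendo_classes D m #= `I_N)%card /\
    (N%:R : rat)%R =
      ((n`!)%:R^-1 *
        \sum_(g : {perm D})
          \prod_(k <- cycle_type g)
            \sum_(1 <= e < m.+1)
              (\sum_(j <- divisors k) (j * ncycles g j)%N%:R) ^+ e)%R.
Proof.
eexists; split; first exact: card_mendo_classes.
have /card_gt0P[d0 _] : 0 < #|D| by rewrite hD.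
(* Clearing the denominator leaves the Cauchy-Frobenius identity between natural numbers, with [n!]
   as the order of the acting group. *)
apply: (canRL (GRing.mulKf _)); first by rewrite Num.Theory.pnatr_eq0 -lt0n fact_gt0.
have -> : n`! = #|[set: {perm D}]|.
  rewrite -hD -cardsT -card_perm; apply: eq_card => g.
  by rewrite inE; apply/fintype.subsetP.
rewrite -GRing.natrM mulnC -Frobenius_Cauchy; last first.
  by apply/actsP => g _ f; rewrite !inE.
rewrite GRing.natr_sum; apply: eq_big => [g|g _]; first by rewrite inE.
rewrite finset.setTI card_fix_relabel // GRing.natr_prod; apply: eq_bigr => k _.
rewrite GRing.natr_sum; apply: eq_bigr => e _.
by rewrite GRing.natrX GRing.natr_sum.
Qed.
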